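(* Let $\mathcal{L}\subseteq\mathrm{Scat}$ be nonempty, downward $\preceq$-closed and ccs. Then $(\mathrm{LO},\trianglelefteq^{\mathcal{L}}_{\mathrm{LO}})$ has the fractal property with respect to its upper cones, that is, for every $L_0\in\mathrm{LO}$, $(\mathrm{LO},\trianglelefteq^{\mathcal{L}}_{\mathrm{LO}})$ embeds into $(L_0{\uparrow^{\mathcal{L}}},\trianglelefteq^{\mathcal{L}}_{\mathrm{LO}})$, where $L_0{\uparrow^{\mathcal{L}}}=\{L\in\mathrm{LO}: L_0\trianglelefteq^{\mathcal{L}}_{\mathrm{LO}}L\}$.
   Context: Linear orders are reflexive and nonempty. $L\preceq L'$ means there is an embedding $f:L\to L'$, i.e. $x\le_L y\iff f(x)\le_{L'}f(y)$. $\mathrm{LO}\subseteq 2^{\mathbb{N}\times\mathbb{N}}$ is the set of (codes for) linear orders with domain $\mathbb{N}$; $\mathrm{Fin}$ is the set of (codes for) nonempty linear orders on finite subsets of $\mathbb{N}$; $\mathrm{Lin}=\mathrm{Fin}\cup\mathrm{LO}$; $\mathrm{Scat}\subseteq\mathrm{Lin}$ is the set of scattered ones (those $L$ with $\mathbb{Q}\not\preceq L$). A class $\mathcal{L}\subseteq\mathrm{Lin}$ is downward $\preceq$-closed if $K\in\mathrm{Lin}$ and $K\preceq L\in\mathcal{L}$ imply $K\in\mathcal{L}$; membership in $\mathcal{L}$ is meant up to isomorphism. A subset $I$ of a linear order $L$ is convex if $x\le_L y\le_L z$ and $x,z\in I$ imply $y\in I$. For $A,B\subseteq L$ write $A\le_L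 B$ (resp. $A<_L B$) if $a\le_L b$ (resp. $a<_L b$) for all $a\in A$, $b\in B$. A $K$-convex partition of $L$ is a partition $(L_k)_{k\in K}$ of $L$ (into nonempty sets) such that $k<_K k'\iff L_k<_L L_{k'}$. The relation $L\trianglelefteq^{\mathcal{L}}L'$ holds iff there are $K\in\mathcal{L}$, a $K$-convex partition $(L_k)_{k\in K}$ of $L$, and an embedding $f$ of $L$ into $L'$ such that $f(L_k)$ is a convex subset of $L'$ for every $k\in K$. $\trianglelefteq^{\mathcal{L}}_{\mathrm{LO}}$ is its restriction to $\mathrm{LO}$. $\mathcal{L}$ is ccs (closed under convex sums) if for all $K,K'\in\mathcal{L}$ and every family $(K'_k)_{k\in K}$ of nonempty convex subsets of $K'$ such that $k_0<_K k_1\Rightarrow K'_{k_0}\le_{K'}K'_{k_1}$, we have $\sum_{k\in K}K'_k\in\mathcal{L}$, where $\sum_{k\in K}K'_k=\{(x,k): k\in K, x\in K'_k\}$ ordered antilexicographically. When $\mathcal{L}$ is ccs, $\trianglelefteq^{\mathcal{L}}$ is a quasi-order. A quasi-order $(X,\precsim)$ embeds into $(Y,\precsim')$ if there is $\varphi:X\to Y$ with $x\precsim x'\iff\varphi(x)\precsim'\varphi(x')$. *)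

(* Defs.v *)
From mathcomp Require Import all_boot all_order all_algebra.
From mathcomp Require Import boolp classical_sets cardinality.

Set Implicit Arguments.
Unset Strict Implicit.
Unset Printing Implicit Defensive.

Local Open Scope classical_set_scope.

(* A relation [r : rel T] codes a linear order on the subset [carrier r] of T,
   which is recovered from [r] by reflexivity. *)
Definition carrier {T : Type} (r : rel T) : set T := [set x | r x x].

Definition linear_order {T : eqType} (r : rel T) : Prop :=
  [/\ carrier r !=set0,
      (forall x y, r x y -> carrier r x /\ carrier r y),
      antisymmetric r,
      transitive r &
      (forall x y, carrier r x -> carrier r y -> r x y || r y x)].

Definition strict {T : eqType} (r : rel T) : rel T :=
  fun x y => r x y && (x != y).

Definition LO : set (rel nat) :=
  [set r | linear_order r /\ carrier r = [set: nat]].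

Definition Fin : set (rel nat) :=
  [set r | linear_order r /\ finite_set (carrier r)].

Definition Lin : set (rel nat) := Fin `|` LO.

(* Only the values of [f] on [carrier r] matter; reflexivity on [carrier r]
   forces [f] to map [carrier r] into [carrier s]. *)
Definition embedding {T U : Type} (r : rel T) (s : rel U) (f : T -> U) : Prop :=
  forall x y, carrier r x -> carrier r y -> s (f x) (f y) = r x y.

Definition embeds {T U : Type} (r : rel T) (s : rel U) : Prop :=
  exists f : T -> U, embedding r s f.

Definition isomorphic {T U : Type} (r : rel T) (s : rel U) : Prop :=
  exists2 f : T -> U, embedding r s f & f @` carrier r = carrier s.

Definition le_rat : rel rat := fun x y => (x <= y)%R.

Definition Scat : set (rel nat) := [set r | Lin r /\ ~ embeds le_rat r].

Definition downward_closed (LL : set (rel nat)) : Prop :=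
  forall K L, Lin K -> LL L -> embeds K L -> LL K.

Definition convex_subset {T : Type} (r : rel T) (I : set T) : Prop :=
  I `<=` carrier r /\ forall x y z, I x -> I z -> r x y -> r y z -> I y.

Definition set_le {T : Type} (r : rel T) (A B : set T) : Prop :=
  forall a b, A a -> B b -> r a b.

Definition set_lt {T : eqType} (r : rel T) (A B : set T) : Prop :=
  forall a b, A a -> B b -> strict r a b.

(* Families indexed by an order [K] are functions on the ambient type, of which
   only the values on [carrier K] matter. *)
Definition convex_partition {S T : eqType} (K : rel S) (r : rel T)
    (P : S -> set T) : Prop :=
  classical_sets.partition (carrier K) P (carrier r) /\
  forall k k', carrier K k -> carrier K k' ->
    (strict K k k' <-> set_lt r (P k) (P k')).

Definition piecewise_convex_embeds (LL : set (rel nat)) (r s : rel nat) : Prop :=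
  exists2 K, LL K & exists (P : nat -> set nat) (f : nat -> nat),
    [/\ convex_partition K r P,
        embedding r s f &
        forall k, carrier K k -> convex_subset s (f @` P k)].

Definition convex_sum {S T : eqType} (K : rel S) (K' : rel T)
    (F : S -> set T) : rel (T * S) :=
  fun p q => `[< [/\ carrier K p.2, F p.2 p.1, carrier K q.2, F q.2 q.1 &
                     strict K p.2 q.2 \/ (p.2 = q.2 /\ K' p.1 q.1)] >].

(* The sum lives on [nat * nat], so membership in [LL] is through an isomorphic
   code on a subset of [nat]. *)
Definition ccs (LL : set (rel nat)) : Prop :=
  forall (K K' : rel nat) (F : nat -> set nat),
    LL K -> LL K' ->
    (forall k, carrier K k -> F k !=set0 /\ convex_subset K' (F k)) ->
    (forall k0 k1, carrier K k0 -> carrier K k1 ->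
       strict K k0 k1 -> set_le K' (F k0) (F k1)) ->
    exists2 M, LL M & isomorphic M (convex_sum K K' F).

(* (A, R) embeds into (B, S), where R and S are restricted to A and B. *)
Definition qo_embeds {X Y : Type} (A : set X) (R : X -> X -> Prop)
    (B : set Y) (S : Y -> Y -> Prop) : Prop :=
  exists phi : X -> Y, (forall x, A x -> B (phi x)) /\
    forall x x', A x -> A x' -> (R x x' <-> S (phi x) (phi x')).

Definition upper_cone (LL : set (rel nat)) (L0 : rel nat) : set (rel nat) :=
  [set L | LO L /\ piecewise_convex_embeds LL L0 L].

(* Main.v *)
From mathcomp Require Import all_boot all_order all_algebra.
From mathcomp Require Import boolp classical_sets cardinality.
From mathcomp Require Import lra.
Require Import Defs.

Set Implicit Arguments.
Unset Strict Implicit.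
Unset Printing Implicit Defensive.

Import Order.TTheory GRing.Theory Num.Theory.
Local Open Scope classical_set_scope.

(** Every point of an order [L] on the natural numbers is replaced by a copy of
    one fixed countable order [N], depending on [L0] only, and the result is
    recoded on [nat] ([reduction]). The order [N] has four consecutive parts: a
    coding part, the rationals, [L0], and the rationals again ([code_sum]). As
    [L0] is convex in [N], it embeds with a single convex piece in every
    [reduction L] ([reduction_above]), and a piecewise convex embedding of [L]
    into [L'] lifts to the reductions with the same index order, because the
    whole copy of [N] over a point is put in the piece of that point
    ([reduction_mono]).

    For the converse ([reduction_reflects]), the coding part is a dense sum of
    finite blocks of consecutive points, whose sizes spell a set [X] of numbers
    on every interval between two points of the form [code_point q]
    ([code_order_coded]). The properties used are invariant under isomorphisms
    of intervals: such an interval has densely many jumps and spells [X], while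
    an interval of rationals has no jump. Cantor's diagonal argument, over the
    countably many pairs of points of [L0], gives an [X] that no interval of
    [L0] spells ([diagonal_not_coded]). Hence an interval of a reduction that
    spells [X] lies in the coding part of a single copy of [N]
    ([coded_in_code]).

    Let [f] be a piecewise convex embedding of [reduction L] into
    [reduction L'], with pieces indexed by a scattered order. Since the index of
    the piece is monotone, over every [l] in [L] some piece contains two points
    [code_point q] of the coding part, and some piece contains an interval of
    the last copy of the rationals ([scattered_monotone]). On the interval
    between the two coding points [f] is an isomorphism onto a convex set, so
    this interval goes into the coding part over a point [g l] of [L']. If
    [l < l'] and [g l = g l'], the rationals over [l] would go into a coding
    part, which has no jumpless interval; so [g] is an embedding of [L] into
    [L']. Its pieces are the sets of those [l] whose two coding points lie in a
    given piece. To see that they have convex images, let [w] lie between two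
    points of such an image: the coding part over [w] is in the range of [f], it
    comes from the coding part over some [l], and [g l = w] since two points of
    one coding part and of one piece cannot be sent to the coding parts over two
    different points: rationals lie between these. *)

(** * Linear orders and their intervals *)

Lemma strictE {T : eqType} (r : rel T) (x y : T) :
  linear_order r -> strict r x y = r x y && ~~ r y x.
Proof.
move=> [_ _ anti _ _]; rewrite /strict; case rxy: (r x y) => //=.
congr (~~ _); apply/idP/idP => [/eqP exy|ryx]; first by rewrite exy in rxy *.
by apply/eqP/anti; rewrite rxy ryx.
Qed.

Lemma lo_strictVle {T : eqType} (r : rel T) (x y : T) :
  linear_order r -> r x x -> r y y -> strict r x y \/ r y x.
Proof.
move=> lr rx ry; rewrite strictE //; case: (lr) => _ _ _ _ /(_ x y rx ry).
by case: (r y x); [right | rewrite orbF => ->; left].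
Qed.

Lemma lo_leP {T : eqType} (r : rel T) (x y : T) :
  linear_order r -> r x y -> x = y \/ strict r x y.
Proof.
move=> lr rxy; case: (eqVneq x y) => [|ne]; [by left | by right; rewrite /strict rxy].
Qed.

Lemma lo_carrier {T : eqType} (r : rel T) (x y : T) :
  linear_order r -> r x y -> r x x /\ r y y.
Proof. by move=> [_ + _ _ _]; apply. Qed.

Lemma lo_trans {T : eqType} (r : rel T) : linear_order r -> transitive r.
Proof. by case. Qed.

Lemma strictW {T : eqType} (r : rel T) (x y : T) : strict r x y -> r x y.
Proof. by case/andP. Qed.

Lemma strict_le_false {T : eqType} (r : rel T) (x y : T) :
  linear_order r -> strict r x y -> r y x -> False.
Proof. by move=> lr; rewrite strictE // => /andP[_ /negP]. Qed.

Lemma strict_le_trans {T : eqType} (r : rel T) (y x z : T) :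
  linear_order r -> strict r x y -> r y z -> strict r x z.
Proof.
move=> lr; rewrite !strictE // => /andP[xy nyx] yz.
rewrite (lo_trans lr xy yz) /=; apply: contra nyx => zx; exact: lo_trans yz zx.
Qed.

Lemma le_strict_trans {T : eqType} (r : rel T) (y x z : T) :
  linear_order r -> r x y -> strict r y z -> strict r x z.
Proof.
move=> lr xy; rewrite !strictE // => /andP[yz nzy].
rewrite (lo_trans lr xy yz) /=; apply: contra nzy => zx; exact: lo_trans zx xy.
Qed.

(** The restriction of [r] to the closed interval with endpoints [x], [y]. *)
Definition itv {T : Type} (r : rel T) (x y : T) : rel T :=
  fun u v => [&& r x u, r u v & r v y].

Lemma strict_itv {T : eqType} (r : rel T) (x y u v : T) :
  strict (itv r x y) u v = [&& r x u, strict r u v & r v y].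
Proof. by rewrite /strict /itv -!andbA (andbC (r v y)). Qed.

Lemma itv_linear {T : eqType} (r : rel T) (x y : T) :
  linear_order r -> r x y -> linear_order (itv r x y).
Proof.
move=> lr xy; have [rx ry] := lo_carrier lr xy.
have tr := lo_trans lr; case: (lr) => _ _ anti _ tot; split.
- by exists x; rewrite /carrier /= /itv rx xy.
- move=> u v /and3P[xu uv vy]; have [ru rv] := lo_carrier lr uv.
  by rewrite /carrier /= /itv xu ru vy (tr _ _ _ uv vy) (tr _ _ _ xu uv) rv.
- by move=> u v /andP[/and3P[_ uv _] /and3P[_ vu _]]; apply: anti; rewrite uv vu.
- move=> b a c /and3P[xa ab _] /and3P[_ bc cy]; rewrite /itv xa cy (tr _ _ _ ab bc) //.
move=> u v /and3P[xu ru uy] /and3P[xv rv vy]; rewrite /itv xu xv uy vy /= !andbT.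
exact: tot.
Qed.

(** * Jumps and blocks *)

(** [b] is the immediate successor of [a]. *)
Definition jump {T : eqType} (r : rel T) (a b : T) : Prop :=
  strict r a b /\ forall w, ~ (strict r a w /\ strict r w b).

(** Jumps are dense: no nontrivial interval is densely ordered. *)
Definition jumpy {T : eqType} (r : rel T) : Prop :=
  forall u v, strict r u v -> exists a b, [/\ r u a, jump r a b & r b v].

Definition jumpless {T : eqType} (r : rel T) : Prop :=
  forall a b, ~ jump r a b.

(** Starting at [u], one can move exactly [m] times to the immediate
    successor. *)
Fixpoint chain {T : eqType} (r : rel T) (m : nat) (u : T) : Prop :=
  if m is m'.+1 then exists2 v, jump r u v & chain r m' v
  else forall v, ~ jump r u v.

(** Some maximal set of consecutive points has exactly [m.+1] elements. *)
Definition has_block {T : eqType} (r : rel T) (m : nat) : Prop :=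
  exists u, [/\ r u u, (forall v, ~ jump r v u) & chain r m u].

Lemma jump_carrier {T : eqType} (r : rel T) (a b : T) :
  linear_order r -> jump r a b -> r a a /\ r b b.
Proof. by move=> lr [/strictW ab _]; apply: lo_carrier ab. Qed.

Section Isomorphism.
Context {T U : eqType} (r : rel T) (s : rel U) (f : T -> U).
Hypotheses (lr : linear_order r) (ls : linear_order s).
Hypotheses (fE : forall u v, r u u -> r v v -> s (f u) (f v) = r u v).
Hypothesis fS : forall w, s w w -> exists2 u, r u u & f u = w.

Lemma iso_strict u v : r u u -> r v v -> strict s (f u) (f v) = strict r u v.
Proof. by move=> ru rv; rewrite !strictE // !fE. Qed.

Lemma iso_jump u v : r u u -> r v v -> jump s (f u) (f v) <-> jump r u v.
Proof.
move=> ru rv; rewrite /jump iso_strict //; split=> -[uv nw]; split=> // w [uw wv].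
  have [_ rw] := lo_carrier lr (strictW uw).
  by apply: (nw (f w)); rewrite !iso_strict.
have [_ /fS[w' rw' w'E]] := lo_carrier ls (strictW uw).
by apply: (nw w'); move: uw wv; rewrite -w'E !iso_strict.
Qed.

Lemma iso_jumpr u w : r u u -> jump s (f u) w -> exists2 v, f v = w & jump r u v.
Proof.
move=> ru j; have [_ /fS[v rv vE]] := jump_carrier ls j.
by exists v => //; apply/iso_jump => //; rewrite vE.
Qed.

Lemma iso_jumpl w v : r v v -> jump s w (f v) -> exists2 u, f u = w & jump r u v.
Proof.
move=> rv j; have [/fS[u ru uE] _] := jump_carrier ls j.
by exists u => //; apply/iso_jump => //; rewrite uE.
Qed.

Lemma iso_chain m u : r u u -> chain s m (f u) <-> chain r m u.
Proof.
elim: m u => [|m IH] u ru /=; split.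
- by move=> nj v j; have [_ rv] := jump_carrier lr j; apply: (nj (f v)); apply/iso_jump.
- by move=> nj w /(iso_jumpr ru)[v _ /nj].
- move=> [w /(iso_jumpr ru)[v <- j] c]; exists v => //.
  by have [_ rv] := jump_carrier lr j; apply/IH.
- move=> [v j c]; have [_ rv] := jump_carrier lr j.
  by exists (f v); [apply/iso_jump | apply/IH].
Qed.

Lemma iso_has_block m : has_block s m <-> has_block r m.
Proof.
split=> -[u [ru nj c]].
  have [u' ru' u'E] := fS ru; exists u'; split=> //; last by apply/iso_chain => //; rewrite u'E.
  move=> v j; have [rv _] := jump_carrier lr j.
  by apply: (nj (f v)); rewrite -u'E; apply/iso_jump.
exists (f u); split; first by rewrite fE.
  by move=> w /(iso_jumpl ru)[v _ /nj].
exact/iso_chain.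
Qed.

Lemma iso_jumpy : jumpy s <-> jumpy r.
Proof.
split=> H u v uv.
  have [ru rv] := lo_carrier lr (strictW uv).
  have := H (f u) (f v); rewrite iso_strict // => /(_ uv) [a' [b' [ua j bv]]].
  have [/fS[a ra aE] /fS[b rb bE]] := jump_carrier ls j; subst a' b'.
  move: ua bv; rewrite !fE // => ua bv.
  by exists a, b; split=> //; apply/iso_jump.
have [/fS[u' ru uE] /fS[v' rv vE]] := lo_carrier ls (strictW uv); subst u v.
move: uv; rewrite iso_strict // => /H[a [b [ua j bv]]].
have [ra rb] := jump_carrier lr j.
by exists (f a), (f b); rewrite !fE //; split=> //; apply/iso_jump.
Qed.

Lemma iso_jumpless : jumpless s <-> jumpless r.
Proof.
split=> H a b j; have := j.
  have [ra rb] := jump_carrier lr j.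
  by move/iso_jump => /(_ ra rb) /H.
have [/fS[a' ra <-] /fS[b' rb <-]] := jump_carrier ls j.
by move/iso_jump => /(_ ra rb) /H.
Qed.

End Isomorphism.

Lemma jump_itv {T : eqType} (r : rel T) (x y a b : T) :
  r x a -> r b y -> jump r a b -> jump (itv r x y) a b.
Proof.
move=> xa bv [ab nw]; split; first by rewrite strict_itv xa ab.
by move=> w; rewrite !strict_itv => -[/and3P[_ aw _] /and3P[_ wb _]]; apply: (nw w).
Qed.

Lemma jumpy_itv {T : eqType} (r : rel T) (x y : T) :
  linear_order r -> jumpy r -> jumpy (itv r x y).
Proof.
move=> lr jr u v; rewrite strict_itv => /and3P[xu /jr[a [b [ua j bv]]] vy].
have tr := lo_trans lr; have ab := strictW j.1.
exists a, b; split; first by rewrite /itv xu ua /= (tr _ _ _ ab) // (tr _ _ _ bv).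
  by apply: jump_itv => //; [apply: tr ua | apply: tr vy].
by rewrite /itv bv vy !andbT (tr _ _ _ _ ab) // (tr _ _ _ xu).
Qed.

(** A jumpy interval has no jumpless subinterval. *)
Lemma jumpy_jumpless {T : eqType} (r : rel T) (x y u v : T) :
  linear_order r -> r x u -> strict r u v -> r v y ->
  jumpy (itv r x y) -> jumpless (itv r u v) -> False.
Proof.
move=> lr xu uv vy H J.
have /H[a [b [/and3P[_ ua _] [+ nw] /and3P[_ bv _]]]] :
  strict (itv r x y) u v by rewrite strict_itv xu uv vy.
rewrite strict_itv => /and3P[xa ab bY].
apply: (J a b); split; first by rewrite strict_itv ua ab bv.
move=> w; rewrite !strict_itv => -[/and3P[_ aw wv] /and3P[_ wb _]].
have tr := lo_trans lr.
apply: (nw w); rewrite !strict_itv aw wb xa bY /= (tr _ _ _ wv) //=.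
by rewrite (tr _ _ _ xa) // strictW.
Qed.

(** Jumps are dense, and the finite maximal sets of consecutive points with at
    least three elements have exactly the sizes [m.+3] with [X m]. *)
Definition coded {T : eqType} (X : nat -> Prop) (r : rel T) : Prop :=
  jumpy r /\ forall m, has_block r m.+2 <-> X m.

(** Being jumpless, jumpy or coded is invariant under an isomorphism between two closed
    intervals; [fS] says that the values of [f] fill the second one. *)
Section IntervalIsomorphism.
Context {T U : eqType} (r : rel T) (s : rel U) (f : T -> U) (x y : T).
Hypotheses (lr : linear_order r) (ls : linear_order s) (rxy : r x y).
Hypothesis fE : embedding r s f.
Hypothesis fS : forall w, s (f x) w -> s w (f y) -> exists2 u, r u u & f u = w.

Let lo_dom : linear_order (itv r x y). Proof. exact: itv_linear. Qed.

Let s_fxy : s (f x) (f y).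
Proof. by have [rx ry] := lo_carrier lr rxy; rewrite fE. Qed.

Let lo_cod : linear_order (itv s (f x) (f y)). Proof. exact: itv_linear. Qed.

Let itv_fE u v : itv r x y u u -> itv r x y v v ->
  itv s (f x) (f y) (f u) (f v) = itv r x y u v.
Proof.
have [rx ry] := lo_carrier lr rxy.
by move=> /and3P[_ ru _] /and3P[_ rv _]; rewrite /itv !fE.
Qed.

Let itv_fS w : itv s (f x) (f y) w w -> exists2 u, itv r x y u u & f u = w.
Proof.
have [rx ry] := lo_carrier lr rxy.
move=> /and3P[xw _ wy]; have [u ru uw] := fS xw wy; exists u => //.
by move: xw wy; rewrite -uw !fE // /itv ru => -> ->.
Qed.

Lemma itv_iso_jumpless :
  jumpless (itv s (f x) (f y)) <-> jumpless (itv r x y).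
Proof. exact: (iso_jumpless lo_dom lo_cod itv_fE itv_fS). Qed.

Lemma itv_iso_jumpy : jumpy (itv s (f x) (f y)) <-> jumpy (itv r x y).
Proof. exact: (iso_jumpy lo_dom lo_cod itv_fE itv_fS). Qed.

Lemma itv_iso_coded X : coded X (itv s (f x) (f y)) <-> coded X (itv r x y).
Proof.
have hE m := iso_has_block lo_dom lo_cod itv_fE itv_fS m.
split=> -[J H]; (split; first by apply/itv_iso_jumpy) => m.
  exact: iff_trans (iff_sym (hE m.+2)) (H m).
exact: iff_trans (hE m.+2) (H m).
Qed.

End IntervalIsomorphism.

(** An embedding whose range is convex. *)
Definition convex_embedding {T U : eqType} (r : rel T) (s : rel U)
    (f : T -> U) : Prop :=
  embedding r s f /\ forall x y w, r x x -> r y y ->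
    s (f x) w -> s w (f y) -> exists2 u, r u u & f u = w.

Lemma convex_embedding_comp {T U V : eqType} (r : rel T) (s : rel U)
    (t : rel V) (f : T -> U) (g : U -> V) :
  convex_embedding r s f -> convex_embedding s t g ->
  convex_embedding r t (g \o f).
Proof.
move=> [fE fS] [gE gS].
have sf z : r z z -> s (f z) (f z) by move=> rz; rewrite fE.
split=> [x y rx ry|x y w rx ry] /=; first by rewrite gE ?fE //; apply: sf.
move=> xw wy; have [v sv vw] := gS _ _ _ (sf _ rx) (sf _ ry) xw wy.
move: xw wy; rewrite -vw !gE //; try exact: sf.
move=> xv vy; have [u ru uv] := fS _ _ _ rx ry xv vy.
by exists u => //; rewrite uv.
Qed.

(** * Sums of linear orders *)

(** The sum over [k] in [K] of the orders [N k]. *)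
Definition lex_sum {S T : eqType} (K : rel S) (N : S -> rel T) : rel (S * T) :=
  fun p q => [&& K p.1 q.1, N p.1 p.2 p.2, N q.1 q.2 q.2 &
                 (p.1 == q.1) ==> N p.1 p.2 q.2].

Lemma lex_sum_carrier {S T : eqType} (K : rel S) (N : S -> rel T) k x :
  lex_sum K N (k, x) (k, x) = K k k && N k x x.
Proof. by rewrite /lex_sum /= eqxx /= !andbb. Qed.

Lemma lex_sum_linear {S T : eqType} (K : rel S) (N : S -> rel T) :
  linear_order K -> (forall k, K k k -> linear_order (N k)) ->
  linear_order (lex_sum K N).
Proof.
move=> lK lN; case: (lK) => -[k0 Kk0] cK aK tK totK; split.
- have [[x Nx] _ _ _ _] := lN k0 Kk0; exists (k0, x).
  by rewrite /carrier /= lex_sum_carrier; apply/andP.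
- move=> [k x] [l y] /and4P[/= kl Nx Ny _].
  by have [Kk Kl] := lo_carrier lK kl; rewrite /carrier /= !lex_sum_carrier Kk Kl Nx.
- move=> [k x] [l y] /andP[/and4P[/= kl Nx Ny h1] /and4P[/= lk _ _ h2]].
  have e : k = l by apply: aK; rewrite kl lk.
  subst l; rewrite eqxx /= in h1 h2; congr pair.
  have [_ _ + _ _] := lN k kl.
  by apply; rewrite h1 h2.
- move=> [l y] [k x] [m z] /and4P[/= kl Nx Ny h1] /and4P[/= lm _ Nz h2].
  rewrite /lex_sum /= (tK _ _ _ kl lm) Nx Nz /=; apply/implyP => /eqP e; subst m.
  have e : k = l by apply: aK; rewrite kl lm.
  subst l; rewrite eqxx /= in h1 h2.
  exact: (lo_trans (lN k kl) h1 h2).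
- move=> [k x] [l y]; rewrite /carrier /= !lex_sum_carrier => /andP[Kk Nx] /andP[Kl Ny].
  rewrite /lex_sum /= Nx Ny /= (eq_sym l).
  have [e|ne] := eqVneq k l; last by rewrite /= !andbT; apply: totK.
  subst l; rewrite Kk /=.
  by have [_ _ _ _ tot] := lN k Kk; apply: tot.
Qed.

Lemma strict_lex_sum {S T : eqType} (K : rel S) (N : S -> rel T) k x l y :
  strict (lex_sum K N) (k, x) (l, y) ->
  strict K k l \/ k = l /\ strict (N k) x y.
Proof.
rewrite /strict /lex_sum /= => /andP[/and4P[kl Nx Ny]].
have [<- /= Nxy ne|ne _ _] := eqVneq k l; last by left; rewrite kl.
by right; split=> //; rewrite Nxy; apply: contra ne => /eqP ->.
Qed.

Lemma lex_sum_lt {S T : eqType} (K : rel S) (N : S -> rel T) k x l y :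
  strict K k l -> N k x x -> N l y y -> strict (lex_sum K N) (k, x) (l, y).
Proof.
move=> /andP[kl ne] Nx Ny; rewrite /strict /lex_sum /= kl Nx Ny (negbTE ne) /=.
by apply: contra ne => /eqP[-> _].
Qed.

Lemma lex_sum_block {S T : eqType} (K : rel S) (N : S -> rel T) k x y :
  K k k -> N k x x -> N k y y ->
  (lex_sum K N (k, x) (k, y) = N k x y) *
  (strict (lex_sum K N) (k, x) (k, y) = strict (N k) x y).
Proof.
move=> Kk Nx Ny; rewrite /strict /lex_sum /= Kk Nx Ny eqxx /=; split=> //.
by congr (_ && ~~ _); apply/eqP/eqP => [[]|->].
Qed.

Lemma lex_sum_convex {S T : eqType} (K : rel S) (N : S -> rel T) k :
  linear_order K -> K k k -> convex_embedding (N k) (lex_sum K N) (pair k).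
Proof.
move=> lK Kk; split=> [x y Nx Ny|x y [l w] Nx Ny]; first by rewrite lex_sum_block.
move=> /and4P[/= kl _ Nw _] /and4P[/= lk _ _ _].
have e : k = l by case: lK => _ _ aK _ _; apply: aK; rewrite kl lk.
by subst l; exists w.
Qed.

(** The sum of two linear orders. *)
Definition add_order {T U : eqType} (r : rel T) (s : rel U) : rel (T + U) :=
  fun p q => match p, q with
    | inl x, inl y => r x y
    | inl x, inr y => r x x && s y y
    | inr _, inl _ => false
    | inr x, inr y => s x y
    end.

Lemma add_order_linear {T U : eqType} (r : rel T) (s : rel U) :
  linear_order r -> linear_order s -> linear_order (add_order r s).
Proof.
move=> lr ls; case: (lr) => -[x0 rx0] cr ar tr totr; case: (ls) => _ cs as_ ts tots.
split.
- by exists (inl x0).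
- move=> [x|x] [y|y] //=; rewrite /carrier /=.
  + by move/(lo_carrier lr).
  + by move/andP.
  + by move/(lo_carrier ls).
- move=> [x|x] [y|y] //=; first by move/ar => ->.
  + by rewrite andbF.
  + by move/as_ => ->.
- move=> [y|y] [x|x] [z|z] //=.
  + exact: tr.
  + by move=> /(lo_carrier lr)[-> _] /andP[].
  + by move=> /andP[-> _] /(lo_carrier ls)[].
  + exact: ts.
- move=> [x|x] [y|y]; rewrite /carrier /=.
  + exact: totr.
  + by move=> -> ->.
  + by move=> -> ->.
  + exact: tots.
Qed.

Lemma add_order_inl {T U : eqType} (r : rel T) (s : rel U) :
  linear_order r -> convex_embedding r (add_order r s) inl.
Proof.
move=> lr; split=> // x y [w|w] rx ry //= /(lo_carrier lr)[_ rw] _.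
by exists w.
Qed.

Lemma add_order_inr {T U : eqType} (r : rel T) (s : rel U) :
  linear_order s -> convex_embedding s (add_order r s) inr.
Proof.
move=> ls; split=> // x y [w|w] sx sy //= /(lo_carrier ls)[_ sw] _.
by exists w.
Qed.

(** * Dense sums of finite blocks *)

(** Each [d] in the order [D] is replaced by [size d] consecutive points. *)
Definition blocks {S : eqType} (D : rel S) (size : S -> nat) : rel (S * nat) :=
  lex_sum D (fun d i j => i <= j < size d)%N.

Section Blocks.
Context {S : eqType} (D : rel S) (size : S -> nat).
Hypotheses (lD : linear_order D) (size_gt1 : forall d, (1 < size d)%N).
Hypothesis denseD : forall d d', strict D d d' ->
  exists e, strict D d e /\ strict D e d'.

Let size_gt0 d : (0 < size d)%N. Proof. exact: ltnW. Qed.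

Lemma blocks_linear : linear_order (blocks D size).
Proof.
apply: lex_sum_linear => // d _; split.
- by exists 0; rewrite /carrier /= size_gt0.
- by move=> i j /andP[ij jd]; rewrite /carrier /= !leqnn jd (leq_ltn_trans ij).
- by move=> i j /andP[/andP[ij _] /andP[ji _]]; apply/eqP; rewrite eqn_leq ij.
- by move=> j i l /andP[ij _] /andP[jl ->]; rewrite (leq_trans ij).
- by move=> i j; rewrite /carrier /= !leqnn => /= -> ->; rewrite !andbT leq_total.
Qed.

Lemma blocks_carrier d i : blocks D size (d, i) (d, i) = D d d && (i < size d)%N.
Proof. by rewrite /blocks lex_sum_carrier leqnn. Qed.

Lemma strict_blocks d i d' i' : strict (blocks D size) (d, i) (d', i') ->
  strict D d d' \/ d = d' /\ (i < i' < size d)%N.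
Proof.
move=> /strict_lex_sum[|[<-]]; first by left.
by rewrite /strict => /andP[/andP[le lt] ne]; right; rewrite ltn_neqAle ne le.
Qed.

Lemma blocks_lt d i d' i' : (i < size d)%N -> (i' < size d')%N ->
  strict D d d' -> strict (blocks D size) (d, i) (d', i').
Proof. by move=> id id' dd'; apply: lex_sum_lt => //; rewrite leqnn. Qed.

Lemma blocks_in d i j : D d d -> (i <= j < size d)%N ->
  blocks D size (d, i) (d, j).
Proof.
move=> Dd /andP[ij jd]; rewrite /blocks lex_sum_block ?leqnn //=; first by rewrite ij.
exact: leq_ltn_trans ij jd.
Qed.

Lemma blocks_strict_in d i j : D d d -> (i < j < size d)%N ->
  strict (blocks D size) (d, i) (d, j).
Proof.
move=> Dd /andP[ij jd]; rewrite /strict blocks_in // ?(ltnW ij) //=.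
by apply/eqP => -[e]; move: ij; rewrite e ltnn.
Qed.

Lemma blocks_jump d i : D d d -> (i.+1 < size d)%N ->
  jump (blocks D size) (d, i) (d, i.+1).
Proof.
move=> Dd id; split; first by apply: blocks_strict_in; rewrite // leqnn.
move=> [d' j] [/strict_blocks h1 /strict_blocks h2].
case: h1 h2 => [dd'|[<- /andP[ij _]]] [d'd|[e /andP[ji _]]].
- by apply: (strict_le_false lD dd'); apply: strictW.
- by subst d'; apply: (strict_le_false lD dd').
- by apply: (strict_le_false lD d'd).
- by move: (leq_trans ij ji); rewrite ltnn.
Qed.

Lemma blocks_jumpy : jumpy (blocks D size).
Proof.
move=> [d i] [d' i'] st; have [cx cy] := lo_carrier blocks_linear (strictW st).
move: cx cy; rewrite !blocks_carrier => /andP[Dd id] /andP[Dd' id'].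
case: (strict_blocks st) => [/denseD[e [de ed']]|[? /andP[ii' _]]].
  have [_ De] := lo_carrier lD (strictW de).
  exists (e, 0), (e, 1); split; first by apply/strictW/blocks_lt.
    exact: blocks_jump.
  exact/strictW/blocks_lt.
subst d'; exists (d, i), (d, i.+1); split; first by rewrite blocks_carrier Dd.
  by apply: blocks_jump => //; apply: leq_ltn_trans id'.
by apply: blocks_in => //; rewrite ii'.
Qed.

Section Interval.
Context (p q : S) (pq : strict D p q).
Let I := itv (blocks D size) (p, 0) (q, 0).

Let Dp : D p p. Proof. exact: (lo_carrier lD (strictW pq)).1. Qed.
Let Dq : D q q. Proof. exact: (lo_carrier lD (strictW pq)).2. Qed.

Let I_lin : linear_order I.
Proof. by apply: itv_linear blocks_linear _; apply/strictW/blocks_lt. Qed.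

Let I_carrier d i : D p d -> strict D d q -> (i < size d)%N -> I (d, i) (d, i).
Proof.
move=> pd dq id; have [_ Dd] := lo_carrier lD pd.
have dd : blocks D size (d, i) (d, i) by rewrite blocks_carrier Dd.
rewrite /I /itv dd /=; apply/andP; split; last exact/strictW/blocks_lt.
case: (lo_leP lD pd) => [e|pd']; last exact/strictW/blocks_lt.
by subst d; apply: blocks_in.
Qed.

Let I_inv d i : I (d, i) (d, i) ->
  [/\ D p d, (i < size d)%N & strict D d q \/ d = q /\ i = 0].
Proof.
move=> /and3P[/and4P[/= pd _ _ _] + dq]; rewrite blocks_carrier => /andP[_ id].
split=> //; case: (lo_leP blocks_linear dq) => [[-> ->]|]; first by right.
by case/strict_blocks => [|[_ /andP[]]] //; left.
Qed.

Let I_jump d i d' i' : jump I (d, i) (d', i') ->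
  [/\ d' = d, i' = i.+1 & strict D d q].
Proof.
move=> j; have [/I_inv[pd id hd] /I_inv[pd' id' hd']] := jump_carrier I_lin j.
case: j; rewrite strict_itv => /and3P[xd + dy] nw.
case/strict_blocks => [dd'|[e /andP[ii' _]]].
  case: (denseD dd') => e [de ed']; case: (nw (e, 0)).
  have eq : strict D e q.
    by case: hd' => [d'q|[<- _]] //; apply: (strict_le_trans lD ed' (strictW d'q)).
  have pe := le_strict_trans lD pd de.
  by rewrite !strict_itv xd dy !blocks_lt // !(strictW (blocks_lt _ _ _)).
subst d'; have dq : strict D d q by case: hd' => // -[_ e]; rewrite e in ii'.
split=> //; apply/eqP; rewrite eq_sym eqn_leq ii' leqNgt; apply/negP => lt.
case: (nw (d, i.+1)); rewrite !strict_itv xd dy.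
have Dd := (lo_carrier lD pd).2.
have id1 := ltn_trans lt id'.
have /and3P[h1 _ h2] := I_carrier pd dq id1.
by rewrite h1 h2 !blocks_strict_in ?ltnSn ?lt.
Qed.

Let I_jumpS d i : D p d -> strict D d q -> (i.+1 < size d)%N ->
  jump I (d, i) (d, i.+1).
Proof.
move=> pd dq id; have Dd := (lo_carrier lD pd).2.
have /and3P[h1 _ _] := I_carrier pd dq (ltnW id).
have /and3P[_ _ h2] := I_carrier pd dq id.
exact/jump_itv/blocks_jump.
Qed.

Let I_chain m d i : D p d -> strict D d q -> (i < size d)%N ->
  chain I m (d, i) <-> (i + m).+1 = size d.
Proof.
move=> pd dq; elim: m i => [|m IH] i id /=.
  rewrite addn0; split=> [nj|e [d' i'] j].
    apply/eqP; rewrite eqn_leq id leqNgt; apply/negP => lt.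
    exact: nj (I_jumpS pd dq lt).
  have [_ /I_inv[_ id' _]] := jump_carrier I_lin j.
  by case: (I_jump j) id' => -> -> _; rewrite e ltnn.
rewrite addnS -addSn; split.
  move=> [[d' i'] j c].
  have [_ /I_inv[_ id' _]] := jump_carrier I_lin j.
  by case: (I_jump j) id' c => -> -> _ id' /IH; apply.
move=> e; have id1 : (i.+1 < size d)%N by rewrite -e ltnS leq_addr.
by exists (d, i.+1); [apply: I_jumpS | apply/IH].
Qed.

(** The right endpoint [(q, 0)] only contributes a block with one point, and
    the left endpoint [(p, 0)] is the first point of its block. *)
Lemma blocks_has_block m : has_block I m.+1 <->
  exists d, [/\ D p d, strict D d q & size d = m.+2].
Proof.
split=> [[[d i] [cd nj c]]|[d [pd dq e]]].
  have [pd id _] := I_inv cd.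
  have dq : strict D d q by case: c => -[d' i'] /I_jump[].
  move/I_chain: c => /(_ pd dq id) e; exists d; split=> //.
  (* otherwise [(d, i)] has an immediate predecessor *)
  suff i0 : i = 0 by rewrite -e i0.
  case: i id nj {cd e} => // i id nj.
  by case: (nj (d, i)); apply: I_jumpS.
exists (d, 0); split; first by apply: I_carrier.
  by move=> [d' i'] /I_jump[].
by apply/I_chain => //; rewrite e.
Qed.

End Interval.
End Blocks.

(** * Piecewise convex embeddings through monotone maps *)

(** An infinite subset of a countable type is enumerated by [nat]. *)
Lemma enumerate_infinite {T : countType} (B : set T) :
  infinite_set B -> exists (e : nat -> T) (d : T -> nat),
    [/\ forall n, B (e n), cancel e d & forall x, B x -> e (d x) = x].
Proof.
move=> iB; have : (B #= [set: nat])%card.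
  by rewrite card_eq_le; apply/andP; split; [apply: countableP | apply/infiniteP].
move=> /card_set_bijP[d [_ inj surj]].
have /choice[e eP] : forall n, exists x, B x /\ d x = n.
  by move=> n; have [x Bx <-] := surj n I; exists x.
exists e, d; split=> [n|n|x Bx]; [exact: (eP n).1 | exact: (eP n).2 |].
by apply: inj; rewrite ?inE //; [exact: (eP _).1 | exact: (eP _).2].
Qed.

Lemma Lin_linear (K : rel nat) : Lin K -> linear_order K.
Proof. by case=> -[]. Qed.

Lemma embedding_inj {T U : eqType} (r : rel T) (s : rel U) (f : T -> U) x y :
  linear_order r -> embedding r s f -> r x x -> r y y -> f x = f y -> x = y.
Proof.
move=> lr fE rx ry e; case: (lr) => _ _ anti _ _; apply: anti.
by rewrite -!fE // -e fE // rx.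
Qed.

Lemma embedding_strict {T U : eqType} (r : rel T) (s : rel U) (f : T -> U) x y :
  linear_order r -> linear_order s -> embedding r s f -> r x x -> r y y ->
  strict s (f x) (f y) = strict r x y.
Proof. by move=> lr ls fE rx ry; rewrite !strictE // !fE. Qed.

(** A strictly increasing map between linear orders is an embedding. *)
Lemma strict_mono_embedding {T U : eqType} (r : rel T) (s : rel U) (f : T -> U) :
  linear_order r -> linear_order s -> (forall x, r x x -> s (f x) (f x)) ->
  (forall x y, strict r x y -> strict s (f x) (f y)) -> embedding r s f.
Proof.
move=> lr ls fc fs x y rx ry; apply/idP/idP => [sxy|/(lo_leP lr)[<-|/fs/strictW //]].
  have [/fs st|//] := lo_strictVle lr ry rx.
  by case: (strict_le_false ls st sxy).
exact: fc.
Qed.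

(** Every nonempty subset of an order in a downward closed class is the range
    of an embedding of an order in that class. *)
Lemma downward_closed_sub (LL : set (rel nat)) (K : rel nat) (B : set nat) :
  LL `<=` Lin -> downward_closed LL -> LL K -> B `<=` carrier K -> B !=set0 ->
  exists K' c, [/\ LL K', embedding K' K c & c @` carrier K' = B].
Proof.
move=> LLin dc LK BK [b0 Bb0].
have lK := Lin_linear (LLin _ LK); case: (lK) => _ cK aK tK totK.
have [fB|iB] := pselect (finite_set B).
  pose K' : rel nat := fun x y => [&& `[< B x >], `[< B y >] & K x y].
  have cK' : carrier K' = B.
    apply/seteqP; split=> x; rewrite /carrier /=; first by move=> /and3P[/asboolP].
    by move=> Bx; rewrite /K' asboolT //=; apply: BK.
  have emb : embedding K' K id.
    by move=> x y; rewrite cK' /K' => Bx By; rewrite !asboolT.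
  exists K', id; split=> //; last by rewrite image_id.
  apply: dc LK _; last by exists id.
  left; split; last by rewrite cK'.
  split.
  - by rewrite cK'; exists b0.
  - by move=> x y /and3P[/asboolP Bx /asboolP By _]; rewrite cK'.
  - by move=> x y /andP[/and3P[_ _ xy] /and3P[_ _ yx]]; apply: aK; rewrite xy yx.
  - by move=> y x z /and3P[Bx By xy] /and3P[_ Bz yz]; rewrite /K' Bx Bz (tK _ _ _ xy yz).
  - rewrite cK' => x y Bx By; rewrite /K' !asboolT //=; exact: totK (BK _ Bx) (BK _ By).
have [e [d [eB ed de]]] := enumerate_infinite iB.
pose K' : rel nat := fun x y => K (e x) (e y).
have cK' : carrier K' = [set: nat].
  by apply/seteqP; split=> // x _; apply: (BK _ (eB x)).
exists K', e; split=> //; last first.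
  apply/seteqP; split=> [_ [x _ <-] //|x Bx].
  by exists (d x); [rewrite cK' | apply: de].
apply: dc LK _; last by exists e.
right; split=> //; split.
- by rewrite cK'; exists 0.
- by rewrite cK'.
- by move=> x y /aK /(can_inj ed).
- by move=> y x z; apply: tK.
- by rewrite cK' => x y _ _; apply: totK; apply: (BK _ (eB _)).
Qed.

(** The data of a piecewise convex embedding [f] of [r] into [s]: the monotone
    map [kappa] sends a point to the index of its piece, and the last clause says
    that the pieces have convex images. *)
Definition piecewise {T U : eqType} (K : rel nat) (r : rel T) (s : rel U)
    (kappa : T -> nat) (f : T -> U) : Prop :=
  [/\ forall x y, r x y -> K (kappa x) (kappa y),
      embedding r s f &
      forall x y w, r x x -> r y y -> kappa x = kappa y ->
        s (f x) w -> s w (f y) ->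
        exists u, [/\ r u u, kappa u = kappa x & f u = w]].

Lemma piecewise_convex_embeds_elim (LL : set (rel nat)) (r s : rel nat) :
  LL `<=` Lin -> linear_order r -> piecewise_convex_embeds LL r s ->
  exists K kappa f, LL K /\ piecewise K r s kappa f.
Proof.
move=> LLin lr [K LK [P [f [[[cov triv ne] ord] fE conv]]]].
have lK := Lin_linear (LLin _ LK).
have /choice[kappa kP] : forall x, exists k, r x x -> K k k /\ P k x.
  move=> x; case rx: (r x x); last by exists 0.
  have : cover (carrier K) P x by rewrite cov.
  by move=> [k Kk Px]; exists k.
have Pr k x : K k k -> P k x -> r x x.
  move=> Kk Px; have : cover (carrier K) P x by exists k.
  by rewrite cov.
exists K, kappa, f; split=> //; split=> //.
  move=> x y xy; have [rx ry] := lo_carrier lr xy.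
  have [Kx Px] := kP _ rx; have [Ky Py] := kP _ ry.
  have [st|//] := lo_strictVle lK Ky Kx.
  have /(_ _ _ Py Px) yx := (ord _ _ Ky Kx).1 st.
  by case: (strict_le_false lr yx xy).
move=> x y w rx ry kxy xw wy; have [Kx Px] := kP _ rx; have [Ky Py] := kP _ ry.
have [_ cv] := conv _ Kx.
have [||u Pu uw] := cv (f x) w (f y) _ _ xw wy; first by exists x.
  by rewrite kxy; exists y.
have ru := Pr _ _ Kx Pu; exists u; split=> //.
have [Ku Pu'] := kP _ ru.
by apply: triv => //; exists u.
Qed.

Lemma piecewise_convex_embeds_intro (LL : set (rel nat)) (K r s : rel nat)
    (kappa f : nat -> nat) :
  LL `<=` Lin -> downward_closed LL -> linear_order r -> linear_order s ->
  LL K -> piecewise K r s kappa f -> piecewise_convex_embeds LL r s.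
Proof.
move=> LLin dc lr ls LK [mono fE conv]; have lK := Lin_linear (LLin _ LK).
have [[x0 rx0] _ _ _ _] := lr.
have [||K' [c [LK' cE cS]]] :=
  @downward_closed_sub LL K (kappa @` carrier r) LLin dc LK.
- by move=> _ [x rx <-]; apply: mono.
- by exists (kappa x0), x0.
have lK' := Lin_linear (LLin _ LK').
have cP k : K' k k -> exists2 x, r x x & kappa x = c k.
  move=> Kk; have : (c @` carrier K') (c k) by exists k.
  by rewrite cS => -[x rx kx]; exists x.
exists K' => //; exists (fun k => [set x | r x x /\ kappa x = c k]), f.
split=> //.
  split; first split.
  - apply/seteqP; split=> [x [k _ []] //|x rx].
    have [k Kk kx] : (c @` carrier K') (kappa x) by rewrite cS; exists x.
    by exists k.
  - move=> k l Kk Kl [x [[_ e1] [_ e2]]].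
    by apply: (embedding_inj lK' cE) => //; rewrite -e1 -e2.
  - by move=> k /cP[x rx kx]; exists x.
  - move=> k l Kk Kl; split=> [st x y [rx ex] [ry ey]|H].
      have [//|yx] := lo_strictVle lr rx ry.
      have := mono _ _ yx; rewrite ex ey => lk.
      move: st; rewrite -(embedding_strict lK' lK cE) // => st.
      by case: (strict_le_false lK st lk).
    have [x rx ex] := cP _ Kk; have [y ry ey] := cP _ Kl.
    have xy : strict r x y by apply: H.
    apply/andP; split; first by rewrite -cE // -ex -ey; apply: mono; apply: strictW.
    apply/eqP => e; subst l.
    have /andP[_] : strict r x x by apply: H.
    by rewrite eqxx.
move=> k Kk; split=> [_ [x [rx _] <-]|_ w _ [x [rx ex] <-] [y [ry ey] <-] xw wy].
  by rewrite /carrier /= fE.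
have [|u [ru uk uw]] := conv x y w rx ry _ xw wy; first by rewrite ex.
by exists u => //; split=> //; rewrite uk.
Qed.

(** A monotone image of the rationals in a scattered order is constant on some
    pair of distinct rationals. *)
Lemma scattered_monotone (K : rel nat) (h : rat -> nat) :
  linear_order K -> ~ embeds le_rat K ->
  (forall p q, (p < q)%R -> K (h p) (h q)) ->
  exists p q, (p < q)%R /\ h p = h q.
Proof.
move=> lK sc mono; apply: contrapT => H; apply: sc; exists h.
have st p q : (p < q)%R -> strict K (h p) (h q).
  move=> pq; rewrite /strict mono //=; apply/eqP => e; apply: H.
  by exists p, q.
move=> p q _ _; rewrite /le_rat.
case: (ltgtP p q) => [pq|qp|->].
- exact: mono.
- by apply/negP => /(strict_le_false lK (st _ _ qp)).
- have := st q (q + 1)%R; rewrite ltrDl ltr01 => /(_ isT) /strictW.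
  by move/(lo_carrier lK) => [].
Qed.

(** * The coding blocks *)

(** The dense order in which the coloring [(q, (n, r)) |-> n] takes every value
    on every interval [(p, _), (q, _)] with [p < q]. *)
Definition colored_rat : rel (rat * (nat * rat)) :=
  lex_sum le_rat (fun=> lex_sum leq (fun=> le_rat)).

Lemma le_rat_linear : linear_order le_rat.
Proof.
split; rewrite /carrier /le_rat /=.
- by exists 0%R.
- by move=> x y _; rewrite !lexx.
- exact: le_anti.
- exact: le_trans.
- by move=> x y _ _; apply: le_total.
Qed.

Lemma leq_linear : linear_order leq.
Proof.
split; rewrite /carrier /=.
- by exists 0.
- by move=> x y _; rewrite !leqnn.
- exact: anti_leq.
- exact: leq_trans.
- by move=> x y _ _; apply: leq_total.
Qed.

Lemma le_rat_refl q : le_rat q q.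
Proof. exact: lexx. Qed.

Lemma strict_rat p q : strict le_rat p q = (p < q)%R.
Proof. by rewrite /strict /le_rat lt_neqAle andbC. Qed.

Lemma le_rat_jumpless : jumpless le_rat.
Proof.
move=> a b [ab nw]; rewrite strict_rat in ab.
by apply: (nw ((a + b) / 2)%R); rewrite !strict_rat; split; lra.
Qed.

Lemma colored_rat_linear : linear_order colored_rat.
Proof.
apply: lex_sum_linear => [|_ _]; first exact: le_rat_linear.
apply: lex_sum_linear => [|_ _]; first exact: leq_linear.
exact: le_rat_linear.
Qed.

Lemma colored_rat_refl d : colored_rat d d.
Proof.
case: d => q [n r]; rewrite /colored_rat !lex_sum_carrier leqnn.
by rewrite !le_rat_refl.
Qed.

Lemma colored_rat_lt p q d d' :
  (p < q)%R -> strict colored_rat (p, d) (q, d').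
Proof.
move=> pq; apply: lex_sum_lt; rewrite ?strict_rat //.
  by case: d => n r; rewrite lex_sum_carrier leqnn le_rat_refl.
by case: d' => n r; rewrite lex_sum_carrier leqnn le_rat_refl.
Qed.

Lemma colored_rat_lt_inner q n r r' :
  (r < r')%R -> strict colored_rat (q, (n, r)) (q, (n, r')).
Proof.
move=> rr'; rewrite /colored_rat.
by rewrite !lex_sum_block ?lex_sum_carrier ?leqnn ?le_rat_refl // strict_rat.
Qed.

Lemma colored_rat_dense d d' : strict colored_rat d d' ->
  exists e, strict colored_rat d e /\ strict colored_rat e d'.
Proof.
move: d d' => [q [n r]] [q' [n' r']].
case/strict_lex_sum => [|[<- /strict_lex_sum[nn'|[<-]]]]; rewrite ?strict_rat.
- move=> qq'; exists (q, (n, r + 1)%R); split.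
    by apply: colored_rat_lt_inner; rewrite ltrDl.
  exact: colored_rat_lt.
- exists (q, (n, r + 1)%R); split.
    by apply: colored_rat_lt_inner; rewrite ltrDl.
  rewrite /colored_rat lex_sum_block ?lex_sum_carrier ?leqnn ?le_rat_refl //.
  by apply: lex_sum_lt => //; rewrite le_rat_refl.
- move=> rr'; exists (q, (n, (r + r') / 2)%R).
  by split; apply: colored_rat_lt_inner; lra.
Qed.

(** The block sizes coding [X]: sizes [n.+3] for [n] in [X], and [2]. *)
Definition code_size (X : nat -> Prop) (d : rat * (nat * rat)) : nat :=
  if `[< X d.2.1 >] then d.2.1.+3 else 2.

Lemma code_size_gt1 X d : (1 < code_size X d)%N.
Proof. by rewrite /code_size; case: ifP. Qed.

(** A dense sum of finite blocks whose sizes code [X]. *)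
Definition code_order (X : nat -> Prop) : rel (rat * (nat * rat) * nat) :=
  blocks colored_rat (code_size X).

Lemma code_order_linear X : linear_order (code_order X).
Proof. exact: blocks_linear colored_rat_linear (code_size_gt1 X). Qed.

Lemma code_order_jumpy X : jumpy (code_order X).
Proof.
exact: (blocks_jumpy colored_rat_linear (code_size_gt1 X) colored_rat_dense).
Qed.

Definition code_point (q : rat) : rat * (nat * rat) * nat := ((q, (0, 0%R)), 0).

Lemma code_point_carrier X q : code_order X (code_point q) (code_point q).
Proof.
by rewrite /code_order blocks_carrier colored_rat_refl ltnW // code_size_gt1.
Qed.

Lemma code_point_lt X p q : (p < q)%R ->
  strict (code_order X) (code_point p) (code_point q).
Proof.
move=> pq; apply: blocks_lt; try exact/ltnW/code_size_gt1.
exact: colored_rat_lt.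
Qed.

Lemma code_order_coded X p q : (p < q)%R ->
  coded X (itv (code_order X) (code_point p) (code_point q)).
Proof.
move=> pq; split.
  by apply: jumpy_itv; [exact: code_order_linear | exact: code_order_jumpy].
move=> m.
have st : strict colored_rat (p, (0, 0%R)) (q, (0, 0%R)) by apply: colored_rat_lt.
apply: iff_trans (blocks_has_block colored_rat_linear (code_size_gt1 X)
  colored_rat_dense st m.+1) _.
split=> [[d [_ _]]|Xm].
  by rewrite /code_size; case: asboolP => // Xd [<-].
exists ((p + q) / 2, (m, 0))%R; split.
- by apply/strictW/colored_rat_lt; lra.
- by apply/colored_rat_lt; lra.
- by rewrite /code_size /= asboolT.
Qed.

(** A set of natural numbers which differs from every set coded by an interval
    of [L0]; the number [n] deals with the interval between the two points of the
    pair that it encodes. *)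
Definition diagonal (L0 : rel nat) (n : nat) : Prop :=
  if unpickle n is Some (a, b) then ~ has_block (itv L0 a b) n.+2 else True.

Lemma diagonal_not_coded (L0 : rel nat) a b :
  ~ coded (diagonal L0) (itv L0 a b).
Proof.
move=> [_ /(_ (pickle (a, b)))]; rewrite /diagonal pickleK.
set P := has_block _ _ => H.
have nP : ~ P by move=> p; apply: H.1 (p) (p).
exact/nP/H.2.
Qed.

(** * The order replacing each point *)

(** The order [N], whose parts are the coding part, the rationals, [L0] and the
    rationals. *)
Definition code_sum (X : nat -> Prop) (L0 : rel nat) :=
  add_order (add_order (code_order X) le_rat) (add_order L0 le_rat).

(** The type of the points of [code_sum X L0]. *)
Definition point_type : countType :=
  (((rat * (nat * rat) * nat) + rat) + (nat + rat))%type.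

Section CodeSum.
Context (X : nat -> Prop) (L0 : rel nat) (lL0 : linear_order L0).
Let N := code_sum X L0.

Let lA := code_order_linear X.
Let lAQ := add_order_linear lA le_rat_linear.
Let lLQ := add_order_linear lL0 le_rat_linear.

Lemma code_sum_linear : linear_order N.
Proof. exact: add_order_linear. Qed.

Lemma code_sum_code : convex_embedding (code_order X) N (inl \o inl).
Proof. by apply: convex_embedding_comp; apply: add_order_inl. Qed.

Lemma code_sum_rat1 : convex_embedding le_rat N (inl \o inr).
Proof.
apply: convex_embedding_comp; last exact: add_order_inl.
exact: add_order_inr le_rat_linear.
Qed.

Lemma code_sum_base : convex_embedding L0 N (inr \o inl).
Proof.
apply: convex_embedding_comp; last exact: add_order_inr.
exact: add_order_inl.
Qed.

Lemma code_sum_rat2 : convex_embedding le_rat N (inr \o inr).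
Proof.
apply: convex_embedding_comp; last exact: add_order_inr.
exact: add_order_inr le_rat_linear.
Qed.

Lemma code_sum_cofinal (x : point_type) :
  N x x -> exists q, N x (inr (inr q)).
Proof.
case: x => [[x|x]|[x|x]]; rewrite /N /= => Nx.
- by exists 0%R; rewrite Nx le_rat_refl.
- by exists 0%R; rewrite !le_rat_refl.
- by exists 0%R; rewrite Nx le_rat_refl.
- by exists x.
Qed.

(** A nontrivial interval lies in the coding part, or in the copy of [L0], or
    contains an interval of one of the two copies of the rationals. *)
Lemma code_sum_interval (x y : point_type) : strict N x y ->
  [\/ exists a b, x = inl (inl a) /\ y = inl (inl b),
      exists a b, x = inr (inl a) /\ y = inr (inl b),
      exists p q, [/\ (p < q)%R, N x (inl (inr p)) & N (inl (inr q)) y] |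
      exists p q, [/\ (p < q)%R, N x (inr (inr p)) & N (inr (inr q)) y]].
Proof.
have lt1 (p : rat) : (p < p + 1)%R by rewrite ltrDl.
have lt2 (p : rat) : (p - 1 < p)%R by rewrite ltrBlDr ltrDl.
move=> st; have := strictW st.
have [Nx Ny] := lo_carrier code_sum_linear (strictW st).
move: x y st Nx Ny => [[a|a]|[a|a]] [[b|b]|[b|b]] st; rewrite /N /= => Na Nb ab //.
- by constructor 1; exists a, b.
- by constructor 3; exists (b - 1)%R, b; rewrite lt2 /= Na !le_rat_refl.
- by constructor 3; exists 0%R, 1%R; rewrite ltr01 Na Nb !le_rat_refl.
- by constructor 3; exists 0%R, 1%R; rewrite ltr01 Na !le_rat_refl.
- constructor 3; exists a, b; rewrite !le_rat_refl; split=> //.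
  rewrite -strict_rat; move: st; rewrite /strict => /andP[_ ne].
  by rewrite ab; apply: contra ne => /eqP ->.
- by constructor 3; exists a, (a + 1)%R; rewrite lt1 Nb !le_rat_refl.
- by constructor 3; exists a, (a + 1)%R; rewrite lt1 !le_rat_refl.
- by constructor 2; exists a, b.
- by constructor 4; exists (b - 1)%R, b; rewrite lt2 Na !le_rat_refl.
- constructor 4; exists a, b; rewrite !le_rat_refl; split=> //.
  rewrite -strict_rat; move: st; rewrite /strict => /andP[_ ne].
  by rewrite ab; apply: contra ne => /eqP ->.
Qed.

End CodeSum.

(** * The reduction *)

Section Reduction.
Context (X : nat -> Prop) (L0 : rel nat) (LO0 : LO L0).
Let lL0 : linear_order L0. Proof. by case: LO0. Qed.
Let L0r n : L0 n n. Proof. by have [_ h] := LO0; have : carrier L0 n by rewrite h. Qed.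
Let N := code_sum X L0.
Let lN : linear_order N := code_sum_linear X lL0.

(* [e] enumerates the points of the orders [lex_sum L (fun=> N)], which are the
   same for all [L] in [LO] *)
Context (e : nat -> nat * point_type) (d : nat * point_type -> nat).
Hypotheses (eN : forall n, N (e n).2 (e n).2) (ed : cancel e d).
Hypothesis de : forall p, N p.2 p.2 -> e (d p) = p.

(** The sum of copies of [N] indexed by [L], as an order on [nat]. *)
Definition reduction (L : rel nat) : rel nat :=
  fun i j => lex_sum L (fun=> N) (e i) (e j).

(** The point of [L] whose copy of [N] contains a given point. *)
Definition base (i : nat) : nat := (e i).1.

(** [i] belongs to the coding part of its copy of [N]. *)
Definition in_code (i : nat) : Prop := exists a, (e i).2 = inl (inl a).

(** The point [code_point q] in the copy of [N] over [l]. *)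
Definition code_at (l : nat) (q : rat) : nat := d (l, inl (inl (code_point q))).

(** The rational [q] in the last part of the copy of [N] over [l]. *)
Definition rat_at (l : nat) (q : rat) : nat := d (l, inr (inr q)).

Let N_code q : N (inl (inl (code_point q))) (inl (inl (code_point q))).
Proof. exact: code_point_carrier. Qed.

Let N_rat q : N (inr (inr q)) (inr (inr q)).
Proof. exact: le_rat_refl. Qed.

Lemma base_code_at l q : base (code_at l q) = l.
Proof. by rewrite /base /code_at de //; apply: N_code. Qed.

Lemma base_rat_at l q : base (rat_at l q) = l.
Proof. by rewrite /base /rat_at de //; apply: N_rat. Qed.

Lemma in_code_at l q : in_code (code_at l q).
Proof. by exists (code_point q); rewrite /code_at de //; apply: N_code. Qed.

Section Properties.
Context (L : rel nat) (LOL : LO L).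
Let R := reduction L.

Lemma LO_linear : linear_order L. Proof. by case: LOL. Qed.
Let lL := LO_linear.

Lemma LO_refl n : L n n.
Proof. by have [_ h] := LOL; have : carrier L n by rewrite h. Qed.

Let lW : linear_order (lex_sum L (fun=> N)).
Proof. exact: lex_sum_linear. Qed.

Lemma reduction_refl i : R i i.
Proof. by rewrite /R /reduction /lex_sum LO_refl eN eqxx. Qed.

Lemma reduction_LO : LO R.
Proof.
have cR : carrier R = [set: nat] by apply/seteqP; split=> // i _; apply: reduction_refl.
case: lW => _ _ aW tW totW; split=> //; split; rewrite ?cR //.
- by move=> i j /aW /(can_inj ed).
- by move=> j i k; apply: tW.
- move=> i j _ _; apply: totW; exact: reduction_refl.
Qed.
Let lR : linear_order R. Proof. by case: reduction_LO. Qed.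

Lemma base_mono i j : R i j -> L (base i) (base j).
Proof. by case/and4P. Qed.

Lemma base_lt i j : strict L (base i) (base j) -> strict R i j.
Proof.
rewrite /base /strict => /andP[le ne]; rewrite /R /reduction /lex_sum le !eN.
rewrite (negbTE ne) /=.
by apply: contra ne => /eqP ->.
Qed.

Lemma reductionE i j : base i = base j -> R i j = N (e i).2 (e j).2.
Proof. by rewrite /R /reduction /lex_sum /base => ->; rewrite !eN eqxx LO_refl. Qed.

(** Convex suborders of [N] occur as convex suborders in every copy of [N]. *)
Lemma reduction_convex {T : eqType} (r : rel T) (f : T -> point_type) l :
  convex_embedding r N f -> convex_embedding r R (fun x => d (l, f x)).
Proof.
move=> fC; have Nf x : r x x -> N (f x) (f x) by move=> rx; rewrite fC.1.
have [gE gS] := convex_embedding_comp fC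
  (lex_sum_convex (fun=> N) lL (LO_refl l)).
split=> [x y rx ry|x y w rx ry]; rewrite /R /reduction !de ?Nf //.
  exact: gE.
move=> xw wy; have [u ru uw] := gS _ _ _ rx ry xw wy.
exists u => //; apply: (can_inj ed); rewrite de; first by rewrite -uw.
exact: Nf.
Qed.

Lemma code_at_lt l p q : (p < q)%R -> strict R (code_at l p) (code_at l q).
Proof.
move=> /(code_point_lt X) st.
have [cE _] := reduction_convex l (code_sum_code X L0).
by rewrite (embedding_strict (code_order_linear X) lR cE) //; apply: code_point_carrier.
Qed.

Lemma code_at_coded l p q : (p < q)%R ->
  coded X (itv R (code_at l p) (code_at l q)).
Proof.
move=> pq; have [cE cS] := reduction_convex l (code_sum_code X L0).
apply/(itv_iso_coded (code_order_linear X) lR _ cE); last exact: code_order_coded.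
  exact/strictW/code_point_lt.
by move=> w; apply: cS; apply: code_point_carrier.
Qed.

Lemma rat_copy_lt (f : rat -> point_type) l p q : convex_embedding le_rat N f ->
  (p < q)%R -> strict R (d (l, f p)) (d (l, f q)) /\
               jumpless (itv R (d (l, f p)) (d (l, f q))).
Proof.
move=> fC pq; have [cE cS] := reduction_convex l fC.
have st : strict le_rat p q by rewrite strict_rat.
split; first by rewrite (embedding_strict le_rat_linear lR cE) //; apply: le_rat_refl.
apply/(itv_iso_jumpless le_rat_linear lR (strictW st) cE).
  by move=> w; apply: cS; apply: le_rat_refl.
move=> a b [ab nw]; apply: (le_rat_jumpless (a := a) (b := b)).
move: ab; rewrite strict_itv => /and3P[pa ab bq]; split=> // w [aw wb].
apply: (nw w); rewrite !strict_itv pa aw wb bq /=.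
by rewrite (lo_trans le_rat_linear (strictW wb) bq)
  (lo_trans le_rat_linear pa (strictW aw)).
Qed.

Lemma rat_at_lt l p q : (p < q)%R -> strict R (rat_at l p) (rat_at l q).
Proof. by move=> pq; have [] := rat_copy_lt l (code_sum_rat2 X lL0) pq. Qed.

Lemma rat_at_jumpless l p q : (p < q)%R ->
  jumpless (itv R (rat_at l p) (rat_at l q)).
Proof. by move=> pq; have [] := rat_copy_lt l (code_sum_rat2 X lL0) pq. Qed.

Lemma in_code_lt_rat i q : in_code i -> strict R i (rat_at (base i) q).
Proof.
move=> [a ia]; have := eN i; rewrite ia => Na; apply/andP; split.
  rewrite reductionE ?base_rat_at // ia /rat_at de; last exact: N_rat.
  by apply/andP; split; [exact: Na | exact: le_rat_refl].
apply/eqP => h; move: ia; rewrite h /rat_at de //; exact: N_rat.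
Qed.

(** Intervals inside one coding part are jumpy. *)
Lemma in_code_jumpy i j : in_code i -> in_code j -> base i = base j -> R i j ->
  jumpy (itv R i j).
Proof.
move=> [a ia] [b jb] bij ij.
have Na := eN i; have Nb := eN j; rewrite ia in Na; rewrite jb in Nb.
have [cE cS] := reduction_convex (base i) (code_sum_code X L0).
have iE : i = d (base i, inl (inl a)).
  by rewrite -[LHS]ed /base -ia -surjective_pairing.
have jE : j = d (base i, inl (inl b)).
  by rewrite -[LHS]ed bij /base -jb -surjective_pairing.
have ab : code_order X a b by move: ij; rewrite iE jE cE.
rewrite iE jE; apply/(itv_iso_jumpy (code_order_linear X) lR ab cE).
  by move=> w; apply: cS.
apply: jumpy_itv; [exact: code_order_linear | exact: code_order_jumpy].
Qed.

(** Intervals coding [X] lie inside one coding part, when no interval of [L0]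
    codes [X]. *)
Lemma coded_in_code i j : (forall a b, ~ coded X (itv L0 a b)) ->
  strict R i j -> coded X (itv R i j) -> [/\ base i = base j, in_code i & in_code j].
Proof.
move=> nX ij [J H].
have noQ u v : R i u -> strict R u v -> R v j -> ~ jumpless (itv R u v).
  by move=> iu uv vj /(jumpy_jumpless lR iu uv vj J).
have bij : base i = base j.
  case: (lo_leP lL (base_mono (strictW ij))) => // lt.
  have [q iq] := code_sum_cofinal (eN i).
  have qq : (q < q + 1)%R by rewrite ltrDl.
  case: (noQ _ _ _ (rat_at_lt (base i) qq) _ (@rat_at_jumpless (base i) _ _ qq)).
    by rewrite reductionE ?base_rat_at // /rat_at de //; apply: N_rat.
  by apply/strictW/base_lt; rewrite base_rat_at.
have st : strict N (e i).2 (e j).2.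
  move: ij; rewrite /strict => /andP[]; rewrite reductionE // => -> /=; apply: contra.
  move=> /eqP h; apply/eqP/(can_inj ed).
  by move: h bij; rewrite /base; case: (e i) => ? ?; case: (e j) => ? ? /= -> ->.
have no (f : rat -> point_type) p q : convex_embedding le_rat N f -> (p < q)%R ->
    N (e i).2 (f p) -> N (f q) (e j).2 -> False.
  move=> fC pq ip qj; have [lt jl] := rat_copy_lt (base i) fC pq.
  have Nf x : N (f x) (f x) by rewrite fC.1 //; apply: le_rat_refl.
  have bd x : base (d (base i, f x)) = base i by rewrite /base de //; apply: Nf.
  apply: (noQ _ _ _ lt _ jl); first by rewrite reductionE ?bd // de //; apply: Nf.
  by rewrite reductionE ?bd // de //; apply: Nf.
case: (code_sum_interval lL0 st) => [[a [b [ia jb]]]|[a [b [ia jb]]]|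
  [p [q [pq ip qj]]]|[p [q [pq ip qj]]]].
- by split=> //; [exists a | exists b].
- have [cE cS] := reduction_convex (base i) (code_sum_base X lL0).
  have iE : i = d (base i, inr (inl a)).
    by rewrite -[LHS]ed /base -ia -surjective_pairing.
  have jE : j = d (base i, inr (inl b)).
    by rewrite -[LHS]ed bij /base -jb -surjective_pairing.
  have ab : L0 a b by move: (strictW ij); rewrite iE jE cE //; apply: L0r.
  case: (nX a b); apply/(itv_iso_coded lL0 lR ab cE).
    by move=> w; apply: cS; apply: L0r.
  by split; [move: J | move: H]; rewrite {1}iE {1}jE.
- by case: (no _ _ _ (code_sum_rat1 X L0) pq ip qj).
- by case: (no _ _ _ (code_sum_rat2 X lL0) pq ip qj).
Qed.

End Properties.

Section Embeddings.
Context (LL : set (rel nat)).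
Hypotheses (LLscat : LL `<=` Scat) (dc : downward_closed LL).
Hypothesis nX : forall a b, ~ coded X (itv L0 a b).

Let LLin : LL `<=` Lin. Proof. by move=> K /LLscat[]. Qed.

Lemma reduction_mono L L' : LO L -> LO L' ->
  piecewise_convex_embeds LL L L' ->
  piecewise_convex_embeds LL (reduction L) (reduction L').
Proof.
move=> LOL LOL' /(piecewise_convex_embeds_elim LLin (LO_linear LOL)).
move=> [K [kappa [f [LK [mono fE conv]]]]].
have lR := LO_linear (reduction_LO LOL).
have lR' := LO_linear (reduction_LO LOL').
pose g i := d (f (base i), (e i).2).
have eg i : e (g i) = (f (base i), (e i).2) by rewrite /g de //; apply: eN.
apply: (piecewise_convex_embeds_intro (K := K) (kappa := kappa \o base)
  (f := g)) => //.
split=> [i j /base_mono /mono //|i j _ _|i j w _ _ kij].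
  rewrite /reduction !eg /lex_sum /= !eN fE; try exact: LO_refl.
  rewrite -/(base i) -/(base j); congr andb.
  congr (_ ==> _); apply/eqP/eqP => [|-> //].
  by apply: (embedding_inj (LO_linear LOL) fE); apply: LO_refl.
move=> /base_mono; rewrite {1}/base eg => iw /base_mono; rewrite {2}/base eg => wj.
have [u [_ uk uw]] := conv _ _ _ (LO_refl LOL _) (LO_refl LOL _) kij iw wj.
have ed_u : e (d (u, (e w).2)) = (u, (e w).2) by rewrite de //; apply: eN.
exists (d (u, (e w).2)); split; first exact: reduction_refl.
  by rewrite /= /base ed_u.
by rewrite /g /base ed_u /= uw -surjective_pairing ed.
Qed.

Lemma reduction_reflects L L' : LO L -> LO L' ->
  piecewise_convex_embeds LL (reduction L) (reduction L') ->
  piecewise_convex_embeds LL L L'.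
Proof.
move=> LOL LOL'.
have lL := LO_linear LOL; have lL' := LO_linear LOL'.
have lR := LO_linear (reduction_LO LOL).
have lR' := LO_linear (reduction_LO LOL').
have Rr i : reduction L i i by apply: reduction_refl.
move=> /(piecewise_convex_embeds_elim LLin lR) [K [kappa [f [LK [mono fE conv]]]]].
have [_ scK] := LLscat LK; have lK := Lin_linear (LLin LK).
have aK a b : K a b -> K b a -> a = b.
  by move=> ab ba; case: lK => _ _ anti _ _; apply: anti; rewrite ab ba.
have fR i j : reduction L' (f i) (f j) = reduction L i j by apply: fE; apply: Rr.
have fst i j : strict (reduction L') (f i) (f j) = strict (reduction L) i j.
  by apply: embedding_strict => //; apply: Rr.
(* inside a piece, [f] carries intervals onto intervals *)
have piece i j : kappa i = kappa j -> forall w, reduction L' (f i) w ->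
    reduction L' w (f j) -> exists2 u, reduction L u u & f u = w.
  move=> kij w iw wj; have [u [Ru _ uw]] := conv _ _ _ (Rr i) (Rr j) kij iw wj.
  by exists u.
have /choice[z zP] : forall l, exists z : nat * nat,
    [/\ strict (reduction L) z.1 z.2, coded X (itv (reduction L) z.1 z.2),
        kappa z.1 = kappa z.2, base z.1 = l & in_code z.1].
  move=> l.
  have [|p [q [pq kpq]]] := scattered_monotone (h := kappa \o code_at l) lK scK.
    by move=> p q pq; apply/mono/strictW/code_at_lt.
  exists (code_at l p, code_at l q); split=> //=.
  - exact: code_at_lt.
  - exact: code_at_coded.
  - exact: base_code_at.
  - exact: in_code_at.
(* [z l] is a pair of coding points over [l] in a common piece *)
pose x l := (z l).1.
have bx l : base (x l) = l by have [] := zP l.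
have cx l : in_code (x l) by have [] := zP l.
have cfx l : in_code (f (x l)).
  have [st cz kz _ _] := zP l.
  have fz : strict (reduction L') (f (x l)) (f (z l).2) by rewrite fst.
  case: (coded_in_code LOL' nX fz) => //.
  exact/(itv_iso_coded lR lR' (strictW st) fE (piece _ _ kz)).
have x_lt l l' : strict L l l' -> strict (reduction L) (x l) (x l').
  by move=> ll'; apply: base_lt; rewrite ?bx.
have x_le l l' : L l l' -> reduction L (x l) (x l').
  by move=> /(lo_leP lL)[->|/x_lt/strictW].
pose g l := base (f (x l)).
(* two points of the same coding part and of the same piece cannot be sent to
   two different coding parts, since rationals lie in between *)
have same i j : in_code i -> in_code j -> base i = base j -> kappa i = kappa j ->
    in_code (f i) -> reduction L i j -> base (f i) = base (f j).
  move=> ci cj bij kij cfi ij.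
  have fij : reduction L' (f i) (f j) by rewrite fR.
  case: (lo_leP lL' (base_mono fij)) => // lt.
  have iu q : reduction L' (f i) (rat_at (base (f i)) q).
    exact: strictW (in_code_lt_rat LOL' q cfi).
  have uj q : reduction L' (rat_at (base (f i)) q) (f j).
    by apply/strictW/base_lt; rewrite ?base_rat_at.
  have [u [_ ku uE]] := conv _ _ _ (Rr i) (Rr j) kij (iu 0%R) (uj 0%R).
  have [v [_ kv vE]] := conv _ _ _ (Rr i) (Rr j) kij (iu 1%R) (uj 1%R).
  have uv : strict (reduction L) u v by rewrite -fst uE vE; apply: rat_at_lt.
  have iu' : reduction L i u by rewrite -fR uE.
  have vj' : reduction L v j by rewrite -fR vE.
  case: (jumpy_jumpless lR iu' uv vj'); first exact: in_code_jumpy.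
  have kuv : kappa u = kappa v by rewrite ku kv.
  apply/(itv_iso_jumpless lR lR' (strictW uv) fE (piece _ _ kuv)).
  by rewrite uE vE; apply: rat_at_jumpless.
have g_lt l l' : strict L l l' -> strict L' (g l) (g l').
  move=> ll'; have fxx : reduction L' (f (x l)) (f (x l')).
    by apply: strictW; rewrite fst; apply: x_lt.
  case: (lo_leP lL' (base_mono fxx)) => // bf.
  (* otherwise the rationals between [x l] and [x l'] go to a coding part *)
  have [|p [q [pq kpq]]] := scattered_monotone (h := kappa \o rat_at l) lK scK.
    by move=> p q pq; apply/mono/strictW/rat_at_lt.
  have pqR : strict (reduction L) (rat_at l p) (rat_at l q) by apply: rat_at_lt.
  have xp : reduction L (x l) (rat_at l p).
    by have := in_code_lt_rat LOL p (cx l); rewrite bx => /strictW.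
  have qx : reduction L (rat_at l q) (x l').
    by apply/strictW/base_lt; rewrite // base_rat_at bx.
  case: (jumpy_jumpless lR' (x := f (x l)) (y := f (x l')) (u := f (rat_at l p))
    (v := f (rat_at l q))); rewrite ?fst ?fR //.
    exact: in_code_jumpy.
  apply/(itv_iso_jumpless lR lR' (strictW pqR) fE (piece _ _ kpq)).
  exact: rat_at_jumpless.
apply: (piecewise_convex_embeds_intro (K := K) (kappa := kappa \o x) (f := g)) => //.
split=> [l l' ll'||a b w _ _ /= kab aw wb] /=.
- exact/mono/x_le.
- by apply: strict_mono_embedding => // l _; apply: LO_refl.
case: (lo_leP lL' aw) => [<-|aw']; first by exists a; split=> //; apply: LO_refl.
case: (lo_leP lL' wb) => [->|wb'].
  by exists b; split=> //; apply: LO_refl.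
(* the coding part over [w] is in the range of [f], which is coded there *)
have aw1 q : reduction L' (f (x a)) (code_at w q).
  by apply/strictW/base_lt; rewrite ?base_code_at.
have wb1 q : reduction L' (code_at w q) (f (x b)).
  by apply/strictW/base_lt; rewrite ?base_code_at.
have [i [_ ki iE]] := conv _ _ _ (Rr (x a)) (Rr (x b)) kab (aw1 0%R) (wb1 0%R).
have [j [_ kj jE]] := conv _ _ _ (Rr (x a)) (Rr (x b)) kab (aw1 1%R) (wb1 1%R).
have ij : strict (reduction L) i j by rewrite -fst iE jE; apply: code_at_lt.
have kij : kappa i = kappa j by rewrite ki kj.
case: (coded_in_code LOL nX ij).
  apply/(itv_iso_coded lR lR' (strictW ij) fE (piece _ _ kij)).
  by rewrite iE jE; apply: code_at_coded.
move=> _ ci _; have cfi : in_code (f i) by rewrite iE; apply: in_code_at.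
have au : L a (base i).
  by rewrite -{1}(bx a); apply: base_mono; rewrite -fR iE.
have ub : L (base i) b.
  by rewrite -{1}(bx b); apply: base_mono; rewrite -fR iE.
have ku : kappa (x (base i)) = kappa (x a).
  by apply: aK; [rewrite kab|]; apply/mono/x_le.
exists (base i); split=> //; first exact: LO_refl.
have -> : w = base (f i) by rewrite iE base_code_at.
have kui : kappa (x (base i)) = kappa i by rewrite ku ki.
have [/strictW ui|iu] := lo_strictVle lR (Rr (x (base i))) (Rr i).
  by apply: same.
by apply/esym/same.
Qed.

Lemma reduction_above L : LL !=set0 -> LO L ->
  piecewise_convex_embeds LL L0 (reduction L).
Proof.
move=> [K LK] LOL; have lR := LO_linear (reduction_LO LOL).
have [[k Kk] _ _ _ _] := Lin_linear (LLin LK).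
have [cE cS] := reduction_convex LOL 0 (code_sum_base X lL0).
apply: (piecewise_convex_embeds_intro (K := K) (kappa := fun=> k)
  (f := fun n => d (0, inr (inl n)))) => //.
split=> // x y w rx ry _ xw wy.
by have [u ru uw] := cS x y w rx ry xw wy; exists u.
Qed.

End Embeddings.
End Reduction.

Lemma point_infinite (X : nat -> Prop) (L0 : rel nat) :
  infinite_set [set p : nat * point_type | code_sum X L0 p.2 p.2].
Proof.
apply: contra_not infinite_nat => /(finite_image fst); apply: sub_finite_set.
by move=> n _; exists (n, inr (inr 0%R)).
Qed.

(** * The fractal property *)

Theorem theorem5p13 (LL : set (rel nat)) :
  LL `<=` Scat -> LL !=set0 -> downward_closed LL -> ccs LL ->
  forall L0 : rel nat, LO L0 ->
    qo_embeds LO (piecewise_convex_embeds LL)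
              (upper_cone LL L0) (piecewise_convex_embeds LL).
Proof.
move=> LLscat LL0 dc _ L0 LO0.
have [e [d [eN ed de]]] := enumerate_infinite (@point_infinite (diagonal L0) L0).
have nX := @diagonal_not_coded L0.
exists (reduction (diagonal L0) L0 e); split=> [L LOL|L L' LOL LOL'].
  split; first exact: (reduction_LO LO0 eN ed).
  exact: (reduction_above LO0 eN ed de).
split; first exact: (reduction_mono LO0 eN ed de).
exact: (reduction_reflects LO0 eN ed de).
Qed.
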